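(* The set $CM_2=\left\{\begin{pmatrix}a&b\\ b&a\end{pmatrix}: a,b\in\mathbb{R}\right\}$ of all $2\times2$ real circulant matrices is a ring under the usual matrix addition and matrix multiplication, and there is a ring isomorphism $$(CM_2,+,\cdot)\cong(LC_2,+,\cdot).$$
   Context: $\mathbb{P}_2$ is the real vector space of all functions $f:\mathbb{R}\to\mathbb{R}$ with $f(t+2)=f(t)$ for all $t$. $I$ is the identity operator and $E$ the unit shift $(Ef)(t)=f(t+1)$ on $\mathbb{P}_2$, so $E^2=I$. $LC_2=\{xI+yE: x,y\in\mathbb{R}\}$ is the ring of operators with addition $(x_1I+y_1E)+(x_2I+y_2E)=(x_1+x_2)I+(y_1+y_2)E$ and multiplication $(x_1I+y_1E)(x_2I+y_2E)=(x_1x_2+y_1y_2)I+(x_1y_2+x_2y_1)E$. *)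

(* Defs.v *)
From HB Require Import structures.
From mathcomp Require Import all_boot all_order all_algebra.
From mathcomp Require Import boolp functions reals ring.

Set Implicit Arguments.
Unset Strict Implicit.
Unset Printing Implicit Defensive.

Import GRing.Theory.
Local Open Scope ring_scope.

Section CM2.
Variable R : realType.

Definition circ2 (a b : R) : 'M[R]_2 :=
  \matrix_(i < 2, j < 2) (if i == j then a else b).

Definition CM2 : pred 'M[R]_2 := fun M => `[< exists a b, M = circ2 a b >].

End CM2.

Section P2.
Variable R : realType.

(* R^o is R seen as a vector space over itself. *)
Definition periodic2 : {pred R -> R^o} :=
  fun f => `[< forall t, f (t + 2) = f t >].

Lemma periodic2_submod_closed : submod_closed periodic2.
Proof.
split=> [|a f g /asboolP fP /asboolP gP]; apply/asboolP => t //.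
by rewrite !fctE fP gP.
Qed.

HB.instance Definition _ :=
  GRing.isSubmodClosed.Build R (R -> R^o) periodic2
    periodic2_submod_closed.

Record P2 := MkP2 { P2fun :> R -> R^o; _ : P2fun \in periodic2 }.

HB.instance Definition _ := [isSub for P2fun].
HB.instance Definition _ := [Choice of P2 by <:].
HB.instance Definition _ := [SubChoice_isSubLmodule of P2 by <:].

Lemma P2_shift_subproof (f : P2) : (fun t => f (t + 1)) \in periodic2.
Proof.
apply/asboolP => t; case: f => f /= /asboolP fP.
by rewrite addrAC fP.
Qed.

Definition opI : P2 -> P2 := id.
Definition opE : P2 -> P2 := fun f => MkP2 (P2_shift_subproof f).

(* The operations are the pointwise ones of the function space P2 -> P2. *)
Definition lc (x y : R) : P2 -> P2 := x *: opI + y *: opE.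

Lemma P2P (f g : P2) : (forall t, f t = g t) -> f = g.
Proof. by move=> fg; apply/val_inj/funext. Qed.

Lemma lcE x y (f : P2) t : lc x y f t = x * f t + y * f (t + 1).
Proof. by []. Qed.

Lemma opEE : opE \o opE = opI.
Proof.
apply/funext => f; apply: P2P => t; case: f => f /= /asboolP fP.
by rewrite -addrA fP.
Qed.

Lemma lcD x1 y1 x2 y2 : lc x1 y1 + lc x2 y2 = lc (x1 + x2) (y1 + y2).
Proof. by rewrite /lc !scalerDl addrACA. Qed.

Lemma lcN x y : - lc x y = lc (- x) (- y).
Proof. by rewrite /lc !scaleNr opprD. Qed.

Lemma lc_comp x1 y1 x2 y2 :
  lc x1 y1 \o lc x2 y2 = lc (x1 * x2 + y1 * y2) (x1 * y2 + x2 * y1).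
Proof.
apply/funext => f; apply: P2P => t; rewrite compE !lcE.
have -> : f (t + 1 + 1) = f t.
  by case: f => f /= /asboolP fP; rewrite -addrA fP.
by ring.
Qed.

Definition isLC2 : {pred P2 -> P2} := fun T => `[< exists x y, T = lc x y >].

Lemma isLC2P T : reflect (exists x y, T = lc x y) (T \in isLC2).
Proof. exact: asboolP. Qed.

Lemma isLC2_zmod_closed : zmod_closed isLC2.
Proof.
split=> [|S T /isLC2P[x1 [y1 ->]] /isLC2P[x2 [y2 ->]]]; apply/isLC2P.
  by exists 0, 0; rewrite /lc !scale0r addr0.
by exists (x1 - x2), (y1 - y2); rewrite lcN lcD.
Qed.

HB.instance Definition _ :=
  GRing.isZmodClosed.Build (P2 -> P2) isLC2 isLC2_zmod_closed.

Record LC2 := MkLC2 { LC2op :> P2 -> P2; _ : LC2op \in isLC2 }.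

HB.instance Definition _ := [isSub for LC2op].
HB.instance Definition _ := [Choice of LC2 by <:].
HB.instance Definition _ := [SubChoice_isSubZmodule of LC2 by <:].

Lemma LC2_one_subproof : opI \in isLC2.
Proof. by apply/isLC2P; exists 1, 0; rewrite /lc scale1r scale0r addr0. Qed.

Lemma LC2_mul_subproof (S T : LC2) : S \o T \in isLC2.
Proof.
case: S T => S /= /isLC2P[x1 [y1 ->]] [T /= /isLC2P[x2 [y2 ->]]].
by apply/isLC2P; rewrite lc_comp; do 2!eexists.
Qed.

Definition LC2_one : LC2 := MkLC2 LC2_one_subproof.

(* Composition; lc_comp is the multiplication formula in the coordinates. *)
Definition LC2_mul (S T : LC2) : LC2 := MkLC2 (LC2_mul_subproof S T).

Lemma LC2_mulA : associative LC2_mul.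
Proof. by move=> S T U; apply: val_inj. Qed.

Lemma LC2_mul1r : left_id LC2_one LC2_mul.
Proof. by move=> S; apply: val_inj. Qed.

Lemma LC2_mulr1 : right_id LC2_one LC2_mul.
Proof. by move=> S; apply: val_inj. Qed.

Lemma LC2_mulDl : left_distributive LC2_mul +%R.
Proof. by move=> S T U; apply: val_inj. Qed.

Lemma LC2_mulDr : right_distributive LC2_mul +%R.
Proof.
move=> [S SP] T U; apply: val_inj; apply/funext => f /=.
case/isLC2P: SP => x [y ->]; apply: P2P => t.
rewrite lcE /= -[RHS]/(lc x y (T f) t + lc x y (U f) t) !lcE.
by rewrite [LHS]/= !fctE !mulrDr addrACA.
Qed.

Lemma LC2_one_neq0 : LC2_one != 0.
Proof.
have c1 : (fun=> 1 : R) \in periodic2 by apply/asboolP.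
apply/eqP => /(congr1 (fun S : LC2 => S (MkP2 c1) 0)) /eqP.
by rewrite [X in X == _]/= oner_eq0.
Qed.

HB.instance Definition _ := GRing.Zmodule_isNzRing.Build LC2
  LC2_mulA LC2_mul1r LC2_mulr1 LC2_mulDl LC2_mulDr LC2_one_neq0.

End P2.

(* Main.v *)
Require Import Defs.
From HB Require Import structures.
From mathcomp Require Import all_boot all_order all_algebra.
From mathcomp Require Import boolp functions reals.
Import GRing.Theory.
Local Open Scope ring_scope.

(** A 2x2 circulant matrix and an operator [x I + y E] are both given by a pair
    of reals, and both multiply as in the group ring of the cyclic group of
    order 2: [circ2_mul] has the same right-hand side as [lc_comp]. Sending
    [circ2 a b] to [lc a b] is therefore a ring morphism, clearly onto.

    It is one-to-one because [I] and [E] are linearly independent, which needs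
    a witness in the space of 2-periodic functions. The indicator [delta] of
    the even integers is 1 at 0 and 0 at 1, so [lc x y delta] takes the value
    [x] at 0 and [y] at 1 ([lc_delta0], [lc_delta1]). An operator is thus
    recovered from its effect on [delta], and this gives an explicit inverse
    of the morphism. *)

(** * The ring of circulant matrices *)

Section Circulant.
Variable R : realType.

Lemma circ2_coef (a b : R) :
  circ2 a b ord0 ord0 = a /\ circ2 a b ord0 ord_max = b.
Proof. by rewrite !mxE. Qed.

Lemma circ2_one : circ2 1 0 = 1 :> 'M[R]_2.
Proof. by apply/matrixP => i j; rewrite !mxE; case: (i == j). Qed.

Lemma circ2_sub (a b c d : R) : circ2 a b - circ2 c d = circ2 (a - c) (b - d).
Proof. by apply/matrixP => i j; rewrite !mxE; case: (i == j). Qed.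

Lemma circ2_mul (a b c d : R) :
  circ2 a b * circ2 c d = circ2 (a * c + b * d) (a * d + c * b).
Proof.
apply/matrixP => i j; rewrite !mxE big_ord_recl big_ord1 !mxE.
by case: i j => [[|[|//]] ?] [[|[|//]] ?] //=; rewrite ?[c * b]mulrC // addrC.
Qed.

Lemma CM2P (M : 'M[R]_2) : reflect (exists a b, M = circ2 a b) (M \in @CM2 R).
Proof. exact: asboolP. Qed.

Lemma CM2_subring_closed : subring_closed (@CM2 R).
Proof.
split=> [|M N /CM2P[a [b ->]] /CM2P[c [d ->]]|
          M N /CM2P[a [b ->]] /CM2P[c [d ->]]]; apply/CM2P.
- by exists 1, 0; rewrite circ2_one.
- by do 2!eexists; exact: circ2_sub.
- by do 2!eexists; exact: circ2_mul.
Qed.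

HB.instance Definition _ :=
  GRing.isSubringClosed.Build 'M[R]_2 (@CM2 R) CM2_subring_closed.

Record circulant :=
  Circulant { circulant_mx : 'M[R]_2; _ : circulant_mx \in @CM2 R }.

HB.instance Definition _ := [isSub for circulant_mx].
HB.instance Definition _ := [Choice of circulant by <:].
HB.instance Definition _ := [SubChoice_isSubNzRing of circulant by <:].

Lemma circ2_in_CM2 (a b : R) : circ2 a b \in @CM2 R.
Proof. by apply/CM2P; exists a, b. Qed.

Definition circ (a b : R) : circulant := Circulant _ (circ2_in_CM2 a b).

Definition diag_coef (M : circulant) : R := circulant_mx M ord0 ord0.
Definition off_coef (M : circulant) : R := circulant_mx M ord0 ord_max.

Lemma diag_coef_circ a b : diag_coef (circ a b) = a.
Proof. by case: (circ2_coef a b). Qed.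

Lemma off_coef_circ a b : off_coef (circ a b) = b.
Proof. by case: (circ2_coef a b). Qed.

Lemma circ_coef M : circ (diag_coef M) (off_coef M) = M.
Proof.
apply: val_inj; case: M => M /= MP; rewrite /diag_coef /off_coef /=.
by case/CM2P: MP => a [b ->]; case: (circ2_coef a b) => -> ->.
Qed.

Lemma circB a b c d : circ a b - circ c d = circ (a - c) (b - d).
Proof. by apply: val_inj; exact: circ2_sub. Qed.

Lemma circM a b c d : circ a b * circ c d = circ (a * c + b * d) (a * d + c * b).
Proof. by apply: val_inj; exact: circ2_mul. Qed.

Lemma circ1 : circ 1 0 = 1.
Proof. by apply: val_inj; exact: circ2_one. Qed.

End Circulant.

(** * Coordinates of an operator in the family I, E *)

Section Operators.
Variable R : realType.

(** The condition is shifted to itself by 2, so this function is 2-periodic,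
    and it tells apart the points 0 and 1 that [E] exchanges; a constant
    function would only detect the sum of the two coordinates. *)
Definition even_indicator (t : R) : R^o :=
  if `[< exists k : int, t = k%:~R * 2 >] then 1 else 0.

Lemma even_indicator_periodic : even_indicator \in @periodic2 R.
Proof.
apply/asboolP => t; rewrite /even_indicator.
congr (if _ then _ else _); apply: asbool_equiv_eq; split=> -[k tk].
  by exists (k - 1); rewrite intrD mulrDl -tk mulN1r addrK.
by exists (k + 1); rewrite intrD mulrDl -tk mul1r.
Qed.

Definition delta : P2 R := MkP2 even_indicator_periodic.

Lemma delta0 : delta 0 = 1.
Proof. by rewrite /= /even_indicator asboolT //; exists 0; rewrite mul0r. Qed.

Lemma delta1 : delta 1 = 0.
Proof.
rewrite /= /even_indicator asboolF // => -[k].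
rewrite -[1]/(1%:~R) -[2]/(2%:~R) -intrM => /intr_inj.
(* The equation 1 = k * 2, now between integers, fails by parity. *)
by move/(congr1 (fun n => (2 %| n)%Z)); rewrite dvdz_mull.
Qed.

Lemma lc_delta0 (x y : R) : lc x y delta 0 = x.
Proof. by rewrite lcE add0r delta0 delta1 mulr1 mulr0 addr0. Qed.

Lemma lc_delta1 (x y : R) : lc x y delta 1 = y.
Proof.
have delta2 : delta (1 + 1) = 1.
  move/asboolP: even_indicator_periodic => periodic.
  by rewrite -[RHS]delta0 -[RHS]periodic add0r.
by rewrite lcE delta1 delta2 mulr0 add0r mulr1.
Qed.

Lemma lc_in_LC2 (x y : R) : lc x y \in @isLC2 R.
Proof. by apply/isLC2P; exists x, y. Qed.

Definition lcop (x y : R) : LC2 R := MkLC2 (lc_in_LC2 x y).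

Lemma lcop_delta (T : LC2 R) : lcop (T delta 0) (T delta 1) = T.
Proof.
apply: val_inj; case: T => T /= /isLC2P[x [y ->]].
by rewrite lc_delta0 lc_delta1.
Qed.

Lemma lcopB a b c d : lcop a b - lcop c d = lcop (a - c) (b - d).
Proof. by apply: val_inj; rewrite /= lcN lcD. Qed.

Lemma lcopM a b c d :
  lcop a b * lcop c d = lcop (a * c + b * d) (a * d + c * b).
Proof. by apply: val_inj; exact: lc_comp. Qed.

Lemma lcop1 : lcop 1 0 = 1.
Proof. by apply: val_inj; rewrite /= /lc scale1r scale0r addr0. Qed.

End Operators.

(** * The isomorphism *)

Section Isomorphism.
Variable R : realType.

Definition circ_to_lc (M : circulant R) : LC2 R :=
  lcop R (diag_coef R M) (off_coef R M).

Definition lc_to_circ (T : LC2 R) : circulant R :=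
  circ R (T (delta R) 0) (T (delta R) 1).

Lemma circ_to_lcE a b : circ_to_lc (circ R a b) = lcop R a b.
Proof. by rewrite /circ_to_lc diag_coef_circ off_coef_circ. Qed.

Lemma circ_to_lc_zmod_morphism : zmod_morphism circ_to_lc.
Proof.
move=> M N; rewrite -(circ_coef R M) -(circ_coef R N).
by rewrite circB !circ_to_lcE lcopB.
Qed.

Lemma circ_to_lc_monoid_morphism : monoid_morphism circ_to_lc.
Proof.
split=> [|M N]; first by rewrite -circ1 circ_to_lcE lcop1.
rewrite -(circ_coef R M) -(circ_coef R N).
by rewrite circM !circ_to_lcE lcopM.
Qed.

HB.instance Definition _ := GRing.isZmodMorphism.Build
  (circulant R) (LC2 R) circ_to_lc circ_to_lc_zmod_morphism.
HB.instance Definition _ := GRing.isMonoidMorphism.Build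
  (circulant R) (LC2 R) circ_to_lc circ_to_lc_monoid_morphism.

Lemma circ_to_lc_bij : bijective circ_to_lc.
Proof.
exists lc_to_circ => [M|T].
  rewrite -[RHS]circ_coef.
  by congr circ; [exact: lc_delta0 | exact: lc_delta1].
by rewrite circ_to_lcE lcop_delta.
Qed.

End Isomorphism.

Theorem theorem2p40 (R : realType) :
  subring_closed (@CM2 R) /\
  exists (CM : subNzRingType (@CM2 R)) (phi : {rmorphism CM -> LC2 R}),
    bijective phi.
Proof.
split; first exact: CM2_subring_closed.
by exists (circulant R), (circ_to_lc R); exact: circ_to_lc_bij.
Qed.
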